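(* Let $1 \le p \le 2$ with Hölder conjugate $q$, $n\ge2$, $0<\epsilon<1$, $0<\delta<1/2$. Run the collision tester (described below) independently $\frac{160}{9}\ln(1/\delta)$ times, each time with failure-probability parameter $0.2$ (so each run uses $45\cdot B$ samples, where $B=\frac{\sqrt n}{(\epsilon n^{1/q})^2}$ if $n\le 1/\epsilon^q$ and $B=\frac12\sqrt{(2/\epsilon)^q}$ if $n\ge 1/\epsilon^q$), and output the majority answer; the total number of samples is \[ m=800\ln(1/\delta)\begin{cases}\dfrac{\sqrt n}{(\epsilon n^{1/q})^2} & n\le\frac1{\epsilon^q},\\[1em] \dfrac12\sqrt{\left(\frac2\epsilon\right)^q} & n\ge\frac1{\epsilon^q}.\end{cases}\] This procedure solves the uniformity testing problem for $\ell_p$ distance with tolerance $\epsilon$ and failure probability $\delta$: if $A=U_n$ it outputs ``uniform'' with probability at least $1-\delta$, and if $\|A-U_n\|_p\ge\epsilon$ it outputs ``not uniform'' with probability at least $1-\delta$.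
   Context: A distribution on support size $n$ is a vector $A\in\mathbb{R}^n$ with $A_i\ge0$, $\sum_iA_i=1$; $U_n$ is the uniform distribution; $\|V\|_p=(\sum_i|V_i|^p)^{1/p}$. Hölder conjugate: $q=p/(p-1)$ for $1<p<\infty$, $q=\infty$ for $p=1$; when $q=\infty$, $n^{1/q}=1$ and $n\le 1/\epsilon^q$ holds for all $n$. The collision tester with failure parameter $\delta'$ and sample count $m'$: draw $m'$ i.i.d. samples from $A$, let $C$ be the number of pairs $j<k$ with equal $j$th and $k$th samples, let $T=\binom{m'}2\frac1n+\sqrt{\frac1{\delta'}\binom{m'}2\frac1n}$, and output ``uniform'' iff $C\le T$. *)

(* Defs.v *)
(* MathComp world: MathComp and MathComp-Analysis, over an abstract realType. *)
From mathcomp Require Export all_boot all_order all_algebra.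
From mathcomp Require Export reals constructive_ereal exp hoelder.

Set Implicit Arguments.
Unset Strict Implicit.
Unset Printing Implicit Defensive.

Import Order.TTheory GRing.Theory Num.Theory.

Local Open Scope ring_scope.

Section Distributions.
Variable R : realType.

Definition is_distribution n (A : 'rV[R]_n) : Prop :=
  (forall i, 0 <= A 0 i) /\ \sum_i A 0 i = 1.

Definition uniform_dist n : 'rV[R]_n := const_mx n%:R^-1.

Definition lp_norm (p : R) n (V : 'rV[R]_n) : R :=
  (\sum_i `|V 0 i| `^ p) `^ p^-1.

(* Probability of the event E when the family (s i)_(i : I) is i.i.d. with
   law A: the product law on the finite set of functions I -> 'I_n. *)
Definition iid_prob n (A : 'rV[R]_n) (I : finType)
    (E : pred {ffun I -> 'I_n}) : R :=
  \sum_(s | E s) \prod_i A 0 (s i).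

(* A deterministic tester reading one sample per index of I; the answer true
   stands for "uniform". *)
Definition solves_uniformity_testing (p : R) n (eps delta : R) (I : finType)
    (tester : pred {ffun I -> 'I_n}) : Prop :=
  forall A : 'rV[R]_n, is_distribution A ->
    (A = uniform_dist n -> 1 - delta <= iid_prob A tester) /\
    (eps <= lp_norm p (A - uniform_dist n) ->
       1 - delta <= iid_prob A (predC tester)).

End Distributions.

Definition collisions n m (s : {ffun 'I_m -> 'I_n}) : nat :=
  #|[set jk : 'I_m * 'I_m | (jk.1 < jk.2)%N && (s jk.1 == s jk.2)]|.

Definition collision_threshold (R : realType) (delta : R) (n m : nat) : R :=
  'C(m, 2)%:R * n%:R^-1 + Num.sqrt (delta^-1 * ('C(m, 2)%:R * n%:R^-1)).

Definition collision_tester (R : realType) (delta : R) n m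
    (s : {ffun 'I_m -> 'I_n}) : bool :=
  (collisions s)%:R <= collision_threshold delta n m.

(* An even number of answers may split equally; tie is the answer then. *)
Definition majority (tie : bool) k (answer : pred 'I_k) : bool :=
  let yes := #|[set i | answer i]| in
  if yes.*2 == k then tie else (k < yes.*2)%N.

(* Run i of the collision tester reads the samples s (i, j), j < m. *)
Definition majority_collision_tester (R : realType) (tie : bool) (delta : R)
    n k m (s : {ffun 'I_k * 'I_m -> 'I_n}) : bool :=
  majority tie
    (fun i : 'I_k => collision_tester delta [ffun j : 'I_m => s (i, j)]).

Section SampleSize.
Variable R : realType.

(* 1 / eps ^ q, which is +oo for q = +oo since 0 < eps < 1. *)
Definition support_cutoff (eps : R) (q : \bar R) : \bar R :=
  if q is r%:E then ((eps `^ r)^-1)%:E else +oo%E.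

(* n ^ (1 / q); the inverse of +oo is 0, so this is 1 for q = +oo. *)
Definition root_size (n : nat) (q : \bar R) : R := n%:R `^ fine (q^-1)%E.

(* A relation rather than a function: when n = 1 / eps ^ q both cases apply and,
   for q > 2, they give different values.  The second case never applies for
   q = +oo. *)
Definition sample_factor (p : R) (n : nat) (eps B : R) : Prop :=
  let q := hoelder_conjugate p%:E in
  ((n%:R%:E <= support_cutoff eps q)%E
     /\ B = Num.sqrt n%:R / (eps * root_size n q) ^+ 2) \/
  ((support_cutoff eps q <= n%:R%:E)%E
     /\ B = 2^-1 * Num.sqrt ((2 / eps) `^ fine q)).

End SampleSize.

(* For 0 <= x only: the absolute value of the integer ceiling. *)
Definition nat_ceil (R : realType) (x : R) : nat := `|Num.ceil x|%N.

(* Main.v *)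
(* Write [alpha = \sum_x A_x ^ 2], [V = A - U_n] and [D = \sum_x V_x ^ 2], so
   that [alpha = 1 / n + D].  The indicator of a collision splits as
   [1(x = y) - alpha = f x + f y + g x y] with [f x = A_x - alpha] and [g]
   degenerate; the resulting terms are pairwise orthogonal, which gives the
   variance of the collision count, and Chebyshev bounds the failure
   probability of one run by 1/4.  In the far case this needs
   [m' sqrt n D >= 45] and [m' ^ 2 D >= 45 ^ 2].  Put
   [kappa = (eps n ^ (1/q)) ^ 2]: the power mean inequality gives
   [n D >= kappa], and the two cases of the sample size are [kappa <= 1] and
   [kappa >= 1].  In the first, both bounds follow from [n D >= kappa] alone.
   In the second, interpolating the l_p norm between l_1 (where
   [\sum_x |V_x| <= 2]) and l_2 gives the second bound, and the first is its
   geometric mean with [n D >= 1].  Finally an exponential moment bound shows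
   that at least half of [k] independent runs fail with probability at most
   [(7/8) ^ k <= delta]. *)
Require Import Defs.
From mathcomp Require Import ring lra zify.
From mathcomp Require Import sequences.

Set Implicit Arguments.
Unset Strict Implicit.
Unset Printing Implicit Defensive.

Import Order.TTheory GRing.Theory Num.Theory.

Local Open Scope ring_scope.

(** * Means under the product law *)

Section IidMean.
Variables (R : realType) (n : nat) (A : 'rV[R]_n) (I : finType).
Implicit Types (F G : {ffun I -> 'I_n} -> R) (s : {ffun I -> 'I_n}).

Definition iid_mean F : R :=
  \sum_(s : {ffun I -> 'I_n}) (\prod_i A 0 (s i)) * F s.

Definition set_sample s (j : I) (x : 'I_n) : {ffun I -> 'I_n} :=
  [ffun i => if i == j then x else s i].

Lemma set_sample_eq s j x : set_sample s j x j = x.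
Proof. by rewrite ffunE eqxx. Qed.

Lemma set_sample_neq s j x i : i != j -> set_sample s j x i = s i.
Proof. by rewrite ffunE => /negbTE ->. Qed.

Lemma iid_probE (E : pred {ffun I -> 'I_n}) :
  iid_prob A E = iid_mean (fun s => (E s)%:R).
Proof.
rewrite /iid_prob /iid_mean big_mkcond; apply: eq_bigr => s _.
by case: (E s); rewrite ?mulr1 ?mulr0.
Qed.

Lemma eq_iid_mean F G : F =1 G -> iid_mean F = iid_mean G.
Proof. by move=> FG; apply: eq_bigr => s _; rewrite FG. Qed.

Lemma iid_meanD F G : iid_mean (fun s => F s + G s) = iid_mean F + iid_mean G.
Proof. by rewrite -big_split; apply: eq_bigr => s _; rewrite mulrDr. Qed.

Lemma iid_meanZ c F : iid_mean (fun s => c * F s) = c * iid_mean F.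
Proof. by rewrite mulr_sumr; apply: eq_bigr => s _; rewrite mulrCA. Qed.

Lemma iid_mean_sum (J : finType) (F : J -> {ffun I -> 'I_n} -> R) :
  iid_mean (fun s => \sum_j F j s) = \sum_j iid_mean (F j).
Proof.
by rewrite exchange_big; apply: eq_bigr => s _; rewrite mulr_sumr.
Qed.

Lemma iid_mean_prod (phi : I -> 'I_n -> R) :
  iid_mean (fun s => \prod_i phi i (s i)) = \prod_i \sum_x A 0 x * phi i x.
Proof.
by rewrite bigA_distr_bigA; apply: eq_bigr => s _; rewrite big_split.
Qed.

Hypothesis distrA : is_distribution A.

Lemma iid_mean_cst c : iid_mean (fun=> c) = c.
Proof.
(* The constant is written with an empty-looking product of ones so that the mean factors into total
   masses, each 1. *)
have -> : iid_mean (fun=> c) = c * iid_mean (fun s => \prod_(i : I) 1).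
  by rewrite -iid_meanZ; apply: eq_iid_mean => s; rewrite big1 ?mulr1.
rewrite (iid_mean_prod (fun _ _ => 1)) big1 ?mulr1// => i _.
by under eq_bigr do rewrite mulr1; case: distrA.
Qed.

Lemma ler_iid_mean F G : (forall s, F s <= G s) -> iid_mean F <= iid_mean G.
Proof.
move=> FG; apply: ler_sum => s _; apply: ler_wpM2l => //.
by apply: prodr_ge0 => i _; case: distrA.
Qed.

Lemma iid_probC (E : pred {ffun I -> 'I_n}) :
  iid_prob A (predC E) = 1 - iid_prob A E.
Proof.
apply/eqP; rewrite eq_sym subr_eq -(iid_mean_cst 1) !iid_probE -iid_meanD.
by apply/eqP/eq_iid_mean => s /=; case: (E s); rewrite ?add0r ?addr0.
Qed.

(* Swapping sample j with an independent sample preserves the joint law. *)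
Lemma iid_mean_resample (j : I) F :
  iid_mean F = iid_mean (fun s => \sum_x A 0 x * F (set_sample s j x)).
Proof.
(* A fresh draw of total mass 1 is adjoined to the samples; [swap] then exchanges it with sample
   [j], leaving the joint weight unchanged. *)
have -> : iid_mean F =
    \sum_(u : {ffun I -> 'I_n} * 'I_n)
      (\prod_i A 0 (u.1 i)) * (A 0 u.2 * F u.1).
  rewrite -(pair_bigA _ (fun s x => (\prod_i A 0 (s i)) * (A 0 x * F s))) /=.
  apply: eq_bigr => s _.
  by rewrite -mulr_sumr -mulr_suml (proj2 distrA) mul1r.
pose swap (u : {ffun I -> 'I_n} * 'I_n) := (set_sample u.1 j u.2, u.1 j).
have swapK : involutive swap.
  move=> [s x]; rewrite /swap /= set_sample_eq; congr (_, _).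
  by apply/ffunP => i; rewrite !ffunE; case: eqP => [->|].
rewrite (reindex_inj (inv_inj swapK)) /=.
rewrite [RHS]/iid_mean; under [RHS]eq_bigr do rewrite mulr_sumr.
rewrite [RHS]pair_bigA /=.
apply: eq_big => // -[s x] _ /=.
rewrite (bigD1 j) //= [in RHS](bigD1 j) //= set_sample_eq.
rewrite (eq_bigr (fun i => A 0 (s i))); first by ring.
by move=> i ij; rewrite set_sample_neq.
Qed.

(** The hypothesis is that the conditional mean given all samples but [j] vanishes. Orthogonality of
    the Hoeffding terms rests on this. *)
Lemma iid_mean_eq0 (j : I) F :
  (forall s, \sum_x A 0 x * F (set_sample s j x) = 0) -> iid_mean F = 0.
Proof.
by move=> F0; rewrite (iid_mean_resample j) (eq_iid_mean (G := fun=> 0)) //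
  iid_mean_cst.
Qed.

Lemma iid_mean1 (j : I) (phi : 'I_n -> R) :
  iid_mean (fun s => phi (s j)) = \sum_x A 0 x * phi x.
Proof.
rewrite (iid_mean_resample j) -[RHS]iid_mean_cst; apply: eq_iid_mean => s.
by apply: eq_bigr => x _; rewrite set_sample_eq.
Qed.

Lemma iid_mean2 (j k : I) (phi : 'I_n -> 'I_n -> R) : j != k ->
  iid_mean (fun s => phi (s j) (s k)) = \sum_x A 0 x * \sum_y A 0 y * phi x y.
Proof.
move=> jk; rewrite (iid_mean_resample k).
rewrite -(iid_mean1 j (fun x => \sum_y A 0 y * phi x y)).
apply: eq_iid_mean => s; apply: eq_bigr => y _.
by rewrite set_sample_eq set_sample_neq.
Qed.

Lemma iid_mean_sqr_orthogonal (J : finType) (w : J -> {ffun I -> 'I_n} -> R) :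
  (forall a b, a != b -> iid_mean (fun s => w a s * w b s) = 0) ->
  iid_mean (fun s => (\sum_a w a s) ^+ 2) =
  \sum_a iid_mean (fun s => w a s ^+ 2).
Proof.
move=> w_orth.
rewrite (eq_iid_mean (G := fun s => \sum_a \sum_b w a s * w b s)); last first.
  by move=> s; rewrite expr2 big_distrlr.
rewrite iid_mean_sum; apply: eq_bigr => a _; rewrite iid_mean_sum.
rewrite (bigD1 a) //= [X in _ + X]big1 ?addr0 // => b ba.
by apply: w_orth; rewrite eq_sym.
Qed.

(** Markov's inequality for [F ^+ 2]. Since [E] need only force [F] away from 0, one-sided tests
    fit. *)
Lemma iid_prob_chebyshev (E : pred {ffun I -> 'I_n}) F (t : R) :
  0 < t -> (forall s, E s -> t <= `|F s|) ->
  iid_prob A E <= iid_mean (fun s => F s ^+ 2) / t ^+ 2.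
Proof.
move=> t0 EF; rewrite ler_pdivlMr ?exprn_gt0 // mulrC iid_probE -iid_meanZ.
apply: ler_iid_mean => s; case: (boolP (E s)) => [/EF tF | _].
  by rewrite mulr1 -(real_normK (num_real (F s))) lerXn2r ?nnegrE// ltW.
by rewrite mulr0 sqr_ge0.
Qed.

End IidMean.

(** * Variance of the collision count *)

Section CollisionMoments.
Variables (R : realType) (n : nat) (A : 'rV[R]_n).

Definition power_sum r : R := \sum_x A 0 x ^+ r.

(** First-order Hoeffding kernel: [A 0 x] is the chance that a fresh sample collides with [x], and
    [power_sum 2] is its mean. *)
Definition mass_dev (x : 'I_n) : R := A 0 x - power_sum 2.

(** Degenerate second-order kernel: the remainder of the centred indicator after [mass_dev x] and
    [mass_dev y] are removed. *)
Definition coll_dev (x y : 'I_n) : R :=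
  (x == y)%:R - A 0 x - A 0 y + power_sum 2.

Hypothesis distrA : is_distribution A.

Lemma power_sumE r : \sum_x A 0 x * A 0 x ^+ r = power_sum r.+1.
Proof. by apply: eq_bigr => x _; rewrite exprS. Qed.

Lemma sum_scaled_mass c : \sum_x A 0 x * c = c.
Proof. by rewrite -mulr_suml (proj2 distrA) mul1r. Qed.

Lemma sum_mass_dev : \sum_x A 0 x * mass_dev x = 0.
Proof.
under eq_bigr do rewrite mulrBr.
by rewrite sumrB (power_sumE 1) sum_scaled_mass subrr.
Qed.

Lemma sum_mass_indic x (phi : 'I_n -> R) :
  \sum_y A 0 y * ((x == y)%:R * phi y) = A 0 x * phi x.
Proof.
rewrite (bigD1 x) //= eqxx mul1r big1 ?addr0 // => y yx.
by rewrite eq_sym (negbTE yx) mul0r mulr0.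
Qed.

Lemma sum_coll_dev x : \sum_y A 0 y * coll_dev x y = 0.
Proof.
have -> : \sum_y A 0 y * coll_dev x y =
    \sum_y A 0 y * ((x == y)%:R * 1) - \sum_y A 0 y * A 0 y ^+ 1
    + \sum_y A 0 y * (power_sum 2 - A 0 x).
  by rewrite -sumrB -big_split; apply: eq_bigr => y _ /=;
    rewrite /coll_dev; ring.
by rewrite sum_mass_indic power_sumE sum_scaled_mass; ring.
Qed.

Lemma coll_devC x y : coll_dev x y = coll_dev y x.
Proof. by rewrite /coll_dev eq_sym; ring. Qed.

Lemma sum_coll_devl y : \sum_x A 0 x * coll_dev x y = 0.
Proof.
by rewrite -[RHS](sum_coll_dev y); apply: eq_bigr => x _; rewrite coll_devC.
Qed.

Lemma sum_mass_dev_sqr :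
  \sum_x A 0 x * mass_dev x ^+ 2 = power_sum 3 - power_sum 2 ^+ 2.
Proof.
have -> : \sum_x A 0 x * mass_dev x ^+ 2 =
    \sum_x A 0 x * A 0 x ^+ 2
    + \sum_x A 0 x * A 0 x ^+ 1 * (- 2 * power_sum 2)
    + \sum_x A 0 x * power_sum 2 ^+ 2.
  by rewrite -!big_split; apply: eq_bigr => x _ /=; rewrite /mass_dev; ring.
by rewrite -mulr_suml !power_sumE sum_scaled_mass; ring.
Qed.

(** An indicator equals its square, so the square splits into a diagonal part and a polynomial in
    the masses. Adding [sum_mass_dev_sqr] twice gives [power_sum 2 - power_sum 2 ^+ 2], the variance
    of one collision indicator. *)
Lemma sum_coll_dev_sqr :
  \sum_x A 0 x * \sum_y A 0 y * coll_dev x y ^+ 2 =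
  power_sum 2 - 2 * power_sum 3 + power_sum 2 ^+ 2.
Proof.
have -> : \sum_x A 0 x * \sum_y A 0 y * coll_dev x y ^+ 2 =
    \sum_x A 0 x * (A 0 x ^+ 1 - 3 * A 0 x ^+ 2
      + 2 * power_sum 2 * A 0 x ^+ 1 + (power_sum 3 - power_sum 2 ^+ 2)).
  apply: eq_bigr => x _; congr (_ * _).
  have -> : \sum_y A 0 y * coll_dev x y ^+ 2 =
      \sum_y A 0 y * ((x == y)%:R * (1 - 2 * (A 0 x + A 0 y - power_sum 2)))
      + \sum_y A 0 y * A 0 y ^+ 2
      + \sum_y A 0 y * A 0 y ^+ 1 * (2 * (A 0 x - power_sum 2))
      + \sum_y A 0 y * (A 0 x - power_sum 2) ^+ 2.
    rewrite -!big_split; apply: eq_bigr => y _ /=; rewrite /coll_dev.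
    by case: (x == y) => /=; ring.
  by rewrite sum_mass_indic -mulr_suml !power_sumE sum_scaled_mass; ring.
have -> : \sum_x A 0 x * (A 0 x ^+ 1 - 3 * A 0 x ^+ 2
      + 2 * power_sum 2 * A 0 x ^+ 1 + (power_sum 3 - power_sum 2 ^+ 2)) =
    \sum_x A 0 x * A 0 x ^+ 1 * (1 + 2 * power_sum 2)
    - \sum_x A 0 x * A 0 x ^+ 2 * 3
    + \sum_x A 0 x * (power_sum 3 - power_sum 2 ^+ 2).
  by rewrite -sumrB -big_split; apply: eq_bigr => x _ /=; ring.
by rewrite sum_scaled_mass -!mulr_suml !power_sumE; ring.
Qed.

(** * Hoeffding decomposition of the collision count *)

Variable m : nat.
Implicit Types s : {ffun 'I_m -> 'I_n}.

(** Each index lies in [m.-1] pairs: reflecting the pairs in the second half of the sum leaves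
    ordered pairs of distinct indices. *)
Lemma sum_ltn_pairs (phi : 'I_m -> R) :
  \sum_(e : 'I_m * 'I_m | (e.1 < e.2)%N) (phi e.1 + phi e.2) =
  m.-1%:R * \sum_j phi j.
Proof.
rewrite big_split /=.
have -> : \sum_(e : 'I_m * 'I_m | (e.1 < e.2)%N) phi e.2 =
    \sum_(e : 'I_m * 'I_m | (e.2 < e.1)%N) phi e.1.
  by rewrite (reindex_inj (inv_inj (f := fun e : 'I_m * 'I_m => (e.2, e.1)) _));
    [| case].
rewrite big_mkcond [X in _ + X]big_mkcond -big_split /=.
rewrite (eq_bigr (fun e : 'I_m * 'I_m => if e.2 != e.1 then phi e.1 else 0));
  last first.
  move=> -[j k] _ /=; rewrite neq_ltn; case: ltngtP;
  by rewrite ?addr0 ?add0r.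
rewrite -(pair_bigA _ (fun j k => if k != j then phi j else 0)) /=.
rewrite mulr_sumr; apply: eq_bigr => j _.
rewrite -big_mkcond sumr_const mulr_natl; congr (_ *+ _).
by rewrite cardC1 card_ord.
Qed.

Lemma card_ltn_pairs :
  #|[pred e : 'I_m * 'I_m | (e.1 < e.2)%N]|%:R = 'C(m, 2)%:R :> R.
Proof.
apply: (mulIf (x := 2%:R)); first by rewrite pnatr_eq0.
have := sum_ltn_pairs (fun=> 1); rewrite !sumr_const card_ord mulrC => E.
rewrite -[RHS]natrM (bin_ffact m 2) ffactnS ffactn1 natrM -E.
by rewrite mulrC mulr_natr.
Qed.

Lemma binR2 : 'C(m, 2)%:R = m%:R * m.-1%:R / 2 :> R.
Proof.
apply: (mulIf (x := 2%:R)); first by rewrite pnatr_eq0.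
by rewrite divfK ?pnatr_eq0 // -!natrM (bin_ffact m 2) ffactnS ffactn1.
Qed.

Lemma collisionsE s :
  (collisions s)%:R = \sum_(e : 'I_m * 'I_m | (e.1 < e.2)%N)
    (s e.1 == s e.2)%:R :> R.
Proof.
rewrite /collisions -sum1_card natr_sum big_mkcond [RHS]big_mkcond /=.
by apply: eq_bigr => e _; rewrite inE; case: ltnP => //= _; case: eqP.
Qed.

Lemma collisions_le s : (collisions s)%:R <= 'C(m, 2)%:R :> R.
Proof.
rewrite collisionsE -card_ltn_pairs -sumr_const; apply: ler_sum => e _.
by case: (_ == _).
Qed.

Lemma hoeffding_decomposition s :
  (collisions s)%:R - 'C(m, 2)%:R * power_sum 2 =
  m.-1%:R * \sum_j mass_dev (s j)
  + \sum_(e : 'I_m * 'I_m | (e.1 < e.2)%N) coll_dev (s e.1) (s e.2).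
Proof.
rewrite -(sum_ltn_pairs (fun j => mass_dev (s j))) collisionsE -card_ltn_pairs.
rewrite mulr_natl -sumr_const -sumrB -big_split; apply: eq_bigr => e _ /=.
by rewrite /mass_dev /coll_dev; ring.
Qed.

(** Linear and pair terms form one family, to which [iid_mean_sqr_orthogonal] applies; pairs out of
    order contribute 0. *)
Definition summand (a : 'I_m + 'I_m * 'I_m) s : R :=
  match a with
  | inl j => m.-1%:R * mass_dev (s j)
  | inr e => if (e.1 < e.2)%N then coll_dev (s e.1) (s e.2) else 0
  end.

Lemma iid_mean_factor0 (j : 'I_m) (F : {ffun 'I_m -> 'I_n} -> R)
    (phi : {ffun 'I_m -> 'I_n} -> 'I_n -> R) (G : {ffun 'I_m -> 'I_n} -> R) :
  (forall s x, F (set_sample s j x) = phi s x * G s) ->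
  (forall s, \sum_x A 0 x * phi s x = 0) -> iid_mean A F = 0.
Proof.
move=> FE phi0; apply: (iid_mean_eq0 distrA (j := j)) => s.
under eq_bigr do rewrite FE mulrA.
by rewrite -mulr_suml phi0 mul0r.
Qed.

Lemma mass_dev_coll_dev_orthogonal j k l : k != l ->
  iid_mean A (fun s : {ffun 'I_m -> 'I_n} =>
    mass_dev (s j) * coll_dev (s k) (s l)) = 0.
Proof.
(* One end of the pair differs from [j]; resampling it kills the degenerate kernel. *)
move=> kl; have [jk|jk] := eqVneq j k.
  apply: (@iid_mean_factor0 l _ (fun s => coll_dev (s k))
    (fun s => mass_dev (s j))) => [s x|s]; last exact: sum_coll_dev.
  by rewrite set_sample_eq !set_sample_neq ?jk // mulrC.
apply: (@iid_mean_factor0 k _ (fun s x => coll_dev x (s l))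
  (fun s => mass_dev (s j))) => [s x|s]; last exact: sum_coll_devl.
by rewrite set_sample_eq !set_sample_neq // 1?eq_sym // mulrC.
Qed.

Lemma summand_orthogonal a b : a != b ->
  iid_mean A (fun s => summand a s * summand b s) = 0.
Proof.
have mean0 : iid_mean A (fun _ : {ffun 'I_m -> 'I_n} => 0) = 0 :> R.
  exact: iid_mean_cst.
case: a b => [j|[k l]] [j'|[k' l']] /=.
- move=> jj'.
  apply: (@iid_mean_factor0 j _ (fun _ => mass_dev)
    (fun s => m.-1%:R ^+ 2 * mass_dev (s j'))) => [s x|s].
    rewrite set_sample_eq set_sample_neq; first by ring.
    by apply: contraNneq jj' => ->.
  exact: sum_mass_dev.
- move=> _; case: ltnP => kl; last first.
    by rewrite -[RHS]mean0; apply: eq_iid_mean => s; rewrite mulr0.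
  under eq_iid_mean do rewrite -mulrA.
  by rewrite iid_meanZ mass_dev_coll_dev_orthogonal ?mulr0 // -val_eqE ltn_eqF.
- move=> _; case: ltnP => kl; last first.
    by rewrite -[RHS]mean0; apply: eq_iid_mean => s; rewrite mul0r.
  under eq_iid_mean do rewrite mulrC -mulrA.
  by rewrite iid_meanZ mass_dev_coll_dev_orthogonal ?mulr0 // -val_eqE ltn_eqF.
case: ltnP => kl; last first.
  by move=> _; rewrite -[RHS]mean0; apply: eq_iid_mean => s; rewrite mul0r.
case: ltnP => kl' ee'; last first.
  by rewrite -[RHS]mean0; apply: eq_iid_mean => s; rewrite mulr0.
(* Two distinct increasing pairs: some end of the first, [k] or [l], is outside the second and can
   be resampled. Otherwise the order forces the pairs to coincide. *)
have [/andP[kk' kl2]|kin] := boolP ((k' != k) && (l' != k)).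
  apply: (@iid_mean_factor0 k _ (fun s x => coll_dev x (s l))
    (fun s => coll_dev (s k') (s l'))) => [s x|s]; last exact: sum_coll_devl.
  by rewrite set_sample_eq !set_sample_neq // -val_eqE gtn_eqF.
have [/andP[lk' ll2]|lin] := boolP ((k' != l) && (l' != l)).
  apply: (@iid_mean_factor0 l _ (fun s => coll_dev (s k))
    (fun s => coll_dev (s k') (s l'))) => [s x|s]; last exact: sum_coll_dev.
  by rewrite set_sample_eq !set_sample_neq // -val_eqE ltn_eqF.
case/negP: ee'; apply/eqP; congr (inr (_, _)); apply: val_inj => /=;
  move: kin lin; rewrite -!val_eqE /=; lia.
Qed.

Lemma collisions_variance :
  iid_mean A (fun s : {ffun 'I_m -> 'I_n} =>
    ((collisions s)%:R - 'C(m, 2)%:R * power_sum 2) ^+ 2) =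
  2 * 'C(m, 2)%:R * m.-1%:R * (power_sum 3 - power_sum 2 ^+ 2)
  + 'C(m, 2)%:R * (power_sum 2 - 2 * power_sum 3 + power_sum 2 ^+ 2).
Proof.
rewrite (eq_iid_mean _ (G := fun s => (\sum_a summand a s) ^+ 2)); last first.
  move=> s; rewrite hoeffding_decomposition big_sumType /= -mulr_sumr.
  by rewrite -[in RHS]big_mkcond.
rewrite (iid_mean_sqr_orthogonal summand_orthogonal) big_sumType /=.
congr (_ + _).
  rewrite (eq_bigr (fun=> m.-1%:R ^+ 2 * (power_sum 3 - power_sum 2 ^+ 2))).
    by rewrite sumr_const card_ord -mulr_natl binR2; field.
  move=> j _; under eq_iid_mean do rewrite exprMn.
  by rewrite iid_meanZ (iid_mean1 distrA j (fun x => mass_dev x ^+ 2))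
    sum_mass_dev_sqr.
rewrite -card_ltn_pairs mulr_natl -sumr_const [RHS]big_mkcond.
apply: eq_bigr => -[k l] _ /=; rewrite inE /=; case: ltnP => kl.
  rewrite (iid_mean2 distrA (fun x y => coll_dev x y ^+ 2)).
    by rewrite sum_coll_dev_sqr.
  by rewrite -val_eqE ltn_eqF.
by rewrite expr0n /= iid_mean_cst.
Qed.

Lemma sqr_power_sum2_le : power_sum 2 ^+ 2 <= power_sum 3.
Proof.
rewrite -subr_ge0 -sum_mass_dev_sqr; apply: sumr_ge0 => x _.
by rewrite mulr_ge0 ?sqr_ge0 //; case: distrA.
Qed.

(** The dropped part is nonpositive by [sqr_power_sum2_le]. The linear part is kept intact because
    it vanishes for the uniform law. *)
Lemma collisions_variance_le :
  iid_mean A (fun s : {ffun 'I_m -> 'I_n} =>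
    ((collisions s)%:R - 'C(m, 2)%:R * power_sum 2) ^+ 2) <=
  2 * 'C(m, 2)%:R * m.-1%:R * (power_sum 3 - power_sum 2 ^+ 2)
  + 'C(m, 2)%:R * power_sum 2.
Proof.
rewrite collisions_variance lerD2l; apply: ler_wpM2l => //.
have := sqr_power_sum2_le; have : 0 <= power_sum 2 ^+ 2 by apply: sqr_ge0.
lra.
Qed.

End CollisionMoments.

(** * Majority amplification *)

Section Amplification.
Variables (R : realType) (n : nat) (A : 'rV[R]_n).

(** Independence of the runs: they read disjoint blocks of samples, and currying splits the product
    law into blocks. *)
Lemma iid_mean_curry (I J : finType) (phi : I -> {ffun J -> 'I_n} -> R) :
  iid_mean A (fun s : {ffun I * J -> 'I_n} =>
    \prod_i phi i [ffun j => s (i, j)]) = \prod_i iid_mean A (phi i).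
Proof.
rewrite /iid_mean bigA_distr_bigA /=.
pose uncurry (S : {ffun I -> {ffun J -> 'I_n}}) : {ffun I * J -> 'I_n} :=
  [ffun ij => S ij.1 ij.2].
pose curry (s : {ffun I * J -> 'I_n}) : {ffun I -> {ffun J -> 'I_n}} :=
  [ffun i => [ffun j => s (i, j)]].
have uncurryK : cancel uncurry curry.
  by move=> S; apply/ffunP => i; apply/ffunP => j; rewrite !ffunE.
have curryK : cancel curry uncurry.
  by move=> s; apply/ffunP => -[i j]; rewrite !ffunE.
rewrite (reindex uncurry) /=; last first.
  by exists curry => x _; [exact: uncurryK | exact: curryK].
apply: eq_bigr => S _; rewrite [RHS]big_split /=; congr (_ * _).
  rewrite pair_bigA /=; by apply: eq_bigr => -[i j] _; rewrite ffunE.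
apply: eq_bigr => i _; congr (phi i _).
by apply/ffunP => j; rewrite !ffunE.
Qed.

Hypothesis distrA : is_distribution A.

(* Exponential moment bound with weight [4 ^ w / 2 ^ k], where [w] counts the
   wrong runs: the weight is at least 1 as soon as [k <= 2 w]. *)
Lemma iid_prob_half_wrong (k : nat) (J : finType)
    (wrong : pred {ffun J -> 'I_n}) :
  iid_prob A wrong <= 4^-1 ->
  iid_prob A (fun s : {ffun 'I_k * J -> 'I_n} =>
    (k <= #|[set i | wrong [ffun j => s (i, j)]]|.*2)%N) <= (7 / 8) ^+ k.
Proof.
move=> wrong_le; rewrite iid_probE.
(* A run weighs 2 if wrong and 1/2 otherwise; with error at most 1/4 the mean is at most 1/2 + 3/8 =
   7/8. *)
pose phi (r : {ffun J -> 'I_n}) : R := (if wrong r then 4 else 1) / 2.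
have phi_mean : iid_mean A phi <= 7 / 8.
  have -> : iid_mean A phi = 2^-1 + 3 / 2 * iid_prob A wrong.
    rewrite iid_probE -iid_meanZ -[X in _ = X + _](iid_mean_cst J distrA).
    rewrite -iid_meanD; apply: eq_iid_mean => r.
    by rewrite /phi /=; case: (wrong r) => /=; field.
  by lra.
have phi_mean0 : 0 <= iid_mean A phi.
  rewrite -(iid_mean_cst J distrA 0); apply: ler_iid_mean => // r.
  by rewrite /phi; case: ifP => _; lra.
apply: (@le_trans _ _ (\prod_(i < k) iid_mean A phi)); last first.
  by rewrite prodr_const card_ord lerXn2r // nnegrE; lra.
rewrite -(iid_mean_curry (fun=> phi)); apply: ler_iid_mean => // s.
set W := [set i | _].
have -> : \prod_(i < k) phi [ffun j => s (i, j)] = 4 ^+ #|W| / 2 ^+ k.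
  rewrite /phi big_split /= prodr_const card_ord exprVn; congr (_ / _).
  rewrite -big_mkcond /= prodr_const; congr (_ ^+ _).
  by apply: eq_card => i; rewrite inE.
have [kW|_] := leqP k _; last by rewrite divr_ge0 // exprn_ge0.
rewrite ler_pdivlMr ?exprn_gt0 // mul1r.
have -> : (4 : R) = 2 ^+ 2 by ring.
rewrite -exprM; apply: ler_weXn2l; first by lra.
by rewrite mul2n.
Qed.

(** At a tie the bound is an equality, so here and in [majority_false_le] the value of [tie] does
    not matter. *)
Lemma majority_true_le k tie (answer : pred 'I_k) :
  majority tie answer -> (k <= #|[set i | answer i]|.*2)%N.
Proof.
rewrite /majority; case: eqP => [-> //|_]; exact: ltnW.
Qed.

Lemma majority_false_le k tie (answer : pred 'I_k) :
  ~~ majority tie answer -> (k <= #|[set i | ~~ answer i]|.*2)%N.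
Proof.
have : (#|[set i | answer i]| + #|[set i | ~~ answer i]| = k)%N.
  rewrite -[RHS]card_ord -(cardsC [set i | answer i]); congr (_ + _)%N.
  by apply: eq_card => i; rewrite !inE.
by rewrite /majority; case: eqP => [|_]; rewrite -?leqNgt; lia.
Qed.

Lemma ler_iid_prob (I : finType) (E F : pred {ffun I -> 'I_n}) :
  (forall s, E s -> F s) -> iid_prob A E <= iid_prob A F.
Proof.
move=> EF; rewrite !iid_probE; apply: ler_iid_mean => // s.
by case: (boolP (E s)) => [/EF ->|]; rewrite ?ler0n.
Qed.

Lemma majority_collision_tester_accepts (tie : bool) (d : R) (k m : nat) :
  iid_prob A (predC (@collision_tester R d n m)) <= 4^-1 ->
  1 - (7 / 8) ^+ k <= iid_prob A (@majority_collision_tester R tie d n k m).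
Proof.
move=> /(iid_prob_half_wrong k) half_wrong.
rewrite lerBlDr addrC -lerBlDr -iid_probC //; apply: le_trans half_wrong.
by apply: ler_iid_prob => s; apply: majority_false_le.
Qed.

Lemma majority_collision_tester_rejects (tie : bool) (d : R) (k m : nat) :
  iid_prob A (@collision_tester R d n m) <= 4^-1 ->
  1 - (7 / 8) ^+ k <=
    iid_prob A (predC (@majority_collision_tester R tie d n k m)).
Proof.
move=> /(iid_prob_half_wrong k) half_wrong.
rewrite iid_probC // lerD2l lerN2; apply: le_trans half_wrong.
by apply: ler_iid_prob => s; apply: majority_true_le.
Qed.

End Amplification.

(** Since 7/8 is at most [expR (- 8^-1)], the power is at most delta to the exponent 20/9, hence at
    most delta. *)
Lemma expn78_le (R : realType) (delta : R) (k : nat) :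
  0 < delta < 2^-1 -> 160 / 9 * ln (delta^-1) <= k%:R -> (7 / 8) ^+ k <= delta.
Proof.
move=> /andP[d0 d1] kd.
have le78 : (7 / 8 : R) <= expR (- 8^-1).
  by have := expR_ge1Dx (- 8^-1 : R); lra.
apply: (@le_trans _ _ (expR (- 8^-1) ^+ k)).
  by rewrite lerXn2r // nnegrE; lra.
rewrite -expRM_natr -[leRHS]lnK ?posrE // ler_expR.
move: kd; rewrite lnV ?posrE //.
have : ln delta <= 0 by rewrite ln_le0; lra.
lra.
Qed.

(** * Norm inequalities *)

Section LpBounds.
Variable R : realType.

(** Young's inequality with exponents 1/t and 1/(1-t); the endpoints, where one exponent would be
    infinite, are checked directly. *)
Lemma powR_weighted_agm (x y t : R) : 0 <= x -> 0 <= y -> 0 <= t <= 1 ->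
  x `^ t * y `^ (1 - t) <= t * x + (1 - t) * y.
Proof.
move=> x0 y0 /andP[t0 t1].
have [->|t_neq0] := eqVneq t 0.
  by rewrite powRr0 subr0 powRr1 // mul0r add0r.
have [->|t_neq1] := eqVneq t 1.
  by rewrite subrr powRr0 powRr1 // mul0r addr0 mulr1 mul1r.
have t_gt0 : 0 < t by rewrite lt_def t_neq0.
have t_lt1 : 0 < 1 - t by rewrite subr_gt0 lt_neqAle t_neq1.
have := @conjugate_powR R (x `^ t) (y `^ (1 - t)) t^-1 (1 - t)^-1
  (powR_ge0 _ _) (powR_ge0 _ _).
rewrite !invr_gt0 !invrK => /(_ t_gt0 t_lt1); rewrite subrKC => /(_ erefl).
by rewrite -!powRrM !mulfV ?gt_eqF // !powRr1 // [x * _]mulrC [y * _]mulrC.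
Qed.

(** Both families are normalised to sum 1 and weighted AM-GM is applied termwise. The endpoint t = 0
    occurs below at p = 2. *)
Lemma sum_powR_hoelder (T : finType) (a b : T -> R) (t : R) :
  (forall i, 0 <= a i) -> (forall i, 0 <= b i) -> 0 <= t <= 1 ->
  \sum_i a i `^ t * b i `^ (1 - t) <=
  (\sum_i a i) `^ t * (\sum_i b i) `^ (1 - t).
Proof.
move=> a0 b0 t01.
have [->|t_neq0] := eqVneq t 0.
  rewrite powRr0 mul1r subr0 powRr1 ?sumr_ge0 //.
  by apply: ler_sum => i _; rewrite powRr0 mul1r powRr1.
have [->|t_neq1] := eqVneq t 1.
  rewrite subrr powRr0 mulr1 powRr1 ?sumr_ge0 //.
  by apply: ler_sum => i _; rewrite powRr0 mulr1 powRr1.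
have sum0 (c : T -> R) : (forall i, 0 <= c i) -> \sum_i c i = 0 ->
    forall i, c i = 0.
  by move=> c0 /eqP; rewrite psumr_eq0 // => /allP c_eq0 i; apply/eqP/c_eq0;
    rewrite mem_index_enum.
have [Sa0|Sa_neq0] := eqVneq (\sum_i a i) 0.
  rewrite big1 ?mulr_ge0 ?powR_ge0 // => i _.
  by rewrite (sum0 a) // powR0 // mul0r.
have [Sb0|Sb_neq0] := eqVneq (\sum_i b i) 0.
  rewrite big1 ?mulr_ge0 ?powR_ge0 // => i _.
  by rewrite (sum0 b) // powR0 ?mulr0 // subr_eq0 eq_sym.
set Sa := \sum_i a i in Sa_neq0 *; set Sb := \sum_i b i in Sb_neq0 *.
have Sa0 : 0 < Sa by rewrite lt_def Sa_neq0 sumr_ge0.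
have Sb0 : 0 < Sb by rewrite lt_def Sb_neq0 sumr_ge0.
have -> : Sa `^ t * Sb `^ (1 - t) =
    \sum_i Sa `^ t * Sb `^ (1 - t) * (t * (a i / Sa) + (1 - t) * (b i / Sb)).
  rewrite -mulr_sumr big_split /= -!mulr_sumr -!mulr_suml !divff //.
  by ring.
apply: ler_sum => i _.
have ai : a i = Sa * (a i / Sa) by rewrite mulrC divfK.
have bi : b i = Sb * (b i / Sb) by rewrite mulrC divfK.
have a'0 : 0 <= a i / Sa by rewrite divr_ge0 // ltW.
have b'0 : 0 <= b i / Sb by rewrite divr_ge0 // ltW.
rewrite {1}ai {1}bi; move: (a i / Sa) (b i / Sb) a'0 b'0 => a' b' a'0 b'0.
rewrite !powRM ?(ltW Sa0) ?(ltW Sb0) // mulrACA.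
by apply: ler_wpM2l; [rewrite mulr_ge0 ?powR_ge0 | apply: powR_weighted_agm].
Qed.

Variables (n : nat) (V : 'rV[R]_n).

Let l2sq : R := \sum_i V 0 i ^+ 2.

Let l2sq_ge0 : 0 <= l2sq. Proof. by apply: sumr_ge0 => i _; apply: sqr_ge0. Qed.

Lemma normr_powR_sqr (x r : R) : `|x| `^ (2 * r) = (x ^+ 2) `^ r.
Proof. by rewrite powRrM powR_mulrn // real_normK // num_real. Qed.

Lemma lp_norm_ge (p eps : R) : 0 < p -> 0 <= eps -> eps <= lp_norm p V ->
  eps `^ p <= \sum_i `|V 0 i| `^ p.
Proof.
move=> p0 eps0 /(ge0_ler_powR (ltW p0)); rewrite !nnegrE /lp_norm.
rewrite powR_ge0 -powRrM mulVf ?gt_eqF // powRr1; first by apply.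
by apply: sumr_ge0 => i _; apply: powR_ge0.
Qed.

(** Hölder against the constant 1 bounds the p-th power sum by [n%:R]^ (1 - p / 2) * l2sq
    [^ (p / 2)]; raising to the power 2/p gives the claim. *)
Lemma l2sq_ge_lp_norm (p eps : R) : 1 <= p <= 2 -> (0 < n)%N -> 0 <= eps ->
  eps <= lp_norm p V -> (eps * n%:R `^ (1 - p^-1)) ^+ 2 <= n%:R * l2sq.
Proof.
move=> /andP[p1 p2] n0 eps0 epsV.
have p0 : 0 < p by lra.
have epsp : eps `^ p <= n%:R `^ (1 - p / 2) * l2sq `^ (p / 2).
  apply: le_trans (lp_norm_ge p0 eps0 epsV) _.
  have t01 : 0 <= 1 - p / 2 <= 1 by lra.
  have := @sum_powR_hoelder 'I_n (fun=> 1) (fun i => V 0 i ^+ 2) (1 - p / 2)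
    (fun _ => ler01) (fun _ => sqr_ge0 _) t01.
  rewrite sumr_const card_ord -/l2sq.
  rewrite (_ : 1 - (1 - p / 2) = p / 2); last by ring.
  apply: le_trans; apply: ler_sum => i _.
  by rewrite powR1 mul1r -normr_powR_sqr (_ : 2 * (p / 2) = p) //; field.
have r0 : 0 <= 2 / p by rewrite divr_ge0 // ltW.
move: epsp => /(ge0_ler_powR r0).
rewrite !nnegrE powR_ge0 mulr_ge0 ?powR_ge0 // => /(_ isT isT).
rewrite powRM ?powR_ge0 // -!powRrM.
have -> : p * (2 / p) = 2 by field; rewrite gt_eqF.
have -> : p / 2 * (2 / p) = 1 by field; rewrite gt_eqF.
rewrite powRr1 // powR_mulrn // => eps2.
rewrite exprMn -[X in _ * X]powR_mulrn ?powR_ge0 // -powRrM.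
apply: (@le_trans _ _ (n%:R `^ ((1 - p / 2) * (2 / p)) * l2sq
  * n%:R `^ ((1 - p^-1) * 2))).
  by rewrite ler_wpM2r ?powR_ge0.
rewrite mulrAC -powRD; last by rewrite pnatr_eq0 -lt0n n0 implybT.
suff -> : (1 - p / 2) * (2 / p) + (1 - p^-1) * 2 = 1 by rewrite powRr1.
by field; rewrite gt_eqF.
Qed.

(** Hölder applied to |v|^p = |v|^(2-p) (v^2)^(p-1), then the power 1/(p-1). The 4 arises as 2 to
    the power p/(p-1) - (2-p)/(p-1) = 2. *)
Lemma l2sq_ge_lp_norm_l1 (p eps : R) : 1 < p <= 2 -> 0 < eps ->
  eps <= lp_norm p V -> \sum_i `|V 0 i| <= 2 ->
  4 <= (2 / eps) `^ (p / (p - 1)) * l2sq.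
Proof.
move=> /andP[p1 p2] eps0 epsV V2.
have p0 : 0 < p by lra.
have pB1 : 0 < p - 1 by lra.
have epsp : eps `^ p <= 2 `^ (2 - p) * l2sq `^ (p - 1).
  apply: le_trans (lp_norm_ge p0 (ltW eps0) epsV) _.
  have t01 : 0 <= 2 - p <= 1 by lra.
  apply: (@le_trans _ _ ((\sum_i `|V 0 i|) `^ (2 - p) * l2sq `^ (p - 1))).
    have := @sum_powR_hoelder 'I_n (fun i => `|V 0 i|) (fun i => V 0 i ^+ 2)
      (2 - p) (fun _ => normr_ge0 _) (fun _ => sqr_ge0 _) t01.
    rewrite -/l2sq (_ : 1 - (2 - p) = p - 1); last by ring.
    apply: le_trans; apply: ler_sum => i _.
    (* An entry may be 0; the exponents still add up because their sum p is nonzero. *)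
    rewrite -normr_powR_sqr -powRD; last first.
      by rewrite (_ : 2 - p + 2 * (p - 1) = p) ?(gt_eqF p0) //; ring.
    by rewrite (_ : 2 - p + 2 * (p - 1) = p) //; ring.
  apply: ler_wpM2r; first exact: powR_ge0.
  by apply: ge0_ler_powR => //; rewrite ?nnegrE ?sumr_ge0 //; lra.
have r0 : 0 <= (p - 1)^-1 by rewrite invr_ge0 ltW.
move: epsp => /(ge0_ler_powR r0).
rewrite !nnegrE powR_ge0 mulr_ge0 ?powR_ge0 // => /(_ isT isT).
rewrite powRM ?powR_ge0 // -!powRrM mulfV ?gt_eqF // powRr1 // => epsq.
rewrite powRM ?invr_ge0 ?(ltW eps0) // -(powR_inv1 (ltW eps0)) -powRrM.
rewrite mulN1r powRN mulrAC ler_pdivlMr ?powR_gt0 //.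
apply: (le_trans (ler_wpM2l _ epsq)) => //.
rewrite mulrA; apply: ler_wpM2r => //.
have -> : (4 : R) = 2 `^ 2 by rewrite powR_mulrn //; ring.
rewrite -powRD ?pnatr_eq0 ?implybT //.
suff -> : 2 + (2 - p) / (p - 1) = p / (p - 1) by [].
by field; rewrite gt_eqF.
Qed.

(** * The Hölder conjugate and the two cases of the sample size *)

Lemma hoelder_conjugate_gt1 (p : R) : 1 < p ->
  hoelder_conjugate p%:E = (p / (p - 1))%:E.
Proof.
move=> p1; rewrite /hoelder_conjugate /= eqe gt_eqF; last lra.
by rewrite -EFinD inver subr_eq0 gt_eqF // -EFinM.
Qed.

Lemma root_size_hoelder_conjugate (p : R) : 1 <= p ->
  root_size n (hoelder_conjugate p%:E) = n%:R `^ (1 - p^-1).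
Proof.
rewrite le_eqVlt => /predU1P[<-|p1].
  by rewrite hoelder_conjugate1 /root_size invey invr1 subrr.
rewrite hoelder_conjugate_gt1 // /root_size inver.
rewrite gt_eqF; last by rewrite divr_gt0; lra.
by congr (_ `^ _) => /=; field; lra.
Qed.

Lemma sample_factor_ge0 (p eps B : R) : 0 <= eps ->
  sample_factor p n eps B -> 0 <= B.
Proof.
move=> eps0 [[_ ->]|[_ ->]].
  by rewrite divr_ge0 ?sqrtr_ge0 ?sqr_ge0.
by rewrite mulr_ge0 ?sqrtr_ge0 // invr_ge0.
Qed.

(** These are the hypotheses of [collision_tester_far] with the constant 45 scaled out. *)
Lemma sample_factor_separates (p eps B : R) : 1 <= p <= 2 -> (0 < n)%N ->
  0 < eps < 1 -> sample_factor p n eps B ->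
  eps <= lp_norm p V -> \sum_i `|V 0 i| <= 2 ->
  1 <= B * Num.sqrt n%:R * l2sq /\ 1 <= B ^+ 2 * l2sq.
Proof.
move=> p12 n0 /andP[eps0 eps1] Bdef epsV V2.
have B0 := sample_factor_ge0 (ltW eps0) Bdef.
have p1 : 1 <= p by case/andP: p12.
have nR0 : 0 < n%:R :> R by rewrite ltr0n.
have sqrtn : Num.sqrt n%:R ^+ 2 = n%:R :> R by rewrite sqr_sqrtr ?ltW.
have := l2sq_ge_lp_norm p12 n0 (ltW eps0) epsV.
move: Bdef; rewrite /sample_factor root_size_hoelder_conjugate //.
set kap := eps * _; have kap0 : 0 < kap by rewrite mulr_gt0 ?powR_gt0.
(* [kap] is the square root of kappa. It equals (eps^q n)^(1/q), so comparing n with 1/eps^q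
   compares [kap] with 1. *)
have kap_exp : 1 < p -> kap = (eps `^ (p / (p - 1)) * n%:R) `^ (1 - p^-1).
  move=> p_gt1; rewrite powRM ?powR_ge0 ?ler0n // -powRrM.
  have -> : p / (p - 1) * (1 - p^-1) = 1 by field; lra.
  by rewrite powRr1 // ltW.
have e0 : 0 <= 1 - p^-1 by rewrite subr_ge0 invf_le1 //; lra.
have pow1 : 1 `^ (1 - p^-1) = 1 :> R by rewrite powR1.
move=> [[cut ->]|[cut BE]] kapn.
  have kap1 : kap <= 1.
    move: p1 cut; rewrite le_eqVlt => /predU1P[p1 _|p1].
      by rewrite /kap -p1 invr1 subrr powRr0 mulr1 ltW.
    rewrite hoelder_conjugate_gt1 //= lee_fin => cut.
    rewrite kap_exp // -[leRHS]pow1; apply: ge0_ler_powR => //.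
    - by rewrite nnegrE mulr_ge0 ?powR_ge0.
    - by rewrite nnegrE.
    - by rewrite mulrC -ler_pdivlMr ?powR_gt0 // div1r.
  split.
    have -> : Num.sqrt n%:R / kap ^+ 2 * Num.sqrt n%:R * l2sq =
        n%:R * l2sq / kap ^+ 2.
      by rewrite -[in RHS]sqrtn; field; rewrite gt_eqF.
    by rewrite ler_pdivlMr ?exprn_gt0 // mul1r.
  have -> : (Num.sqrt n%:R / kap ^+ 2) ^+ 2 * l2sq = n%:R * l2sq / kap ^+ 4.
    by rewrite -[in RHS]sqrtn; field; rewrite gt_eqF.
  (* As [kap] is at most 1, its fourth power is at most its square. *)
  rewrite ler_pdivlMr ?exprn_gt0 // mul1r; apply: le_trans kapn.
  by apply: ler_wiXn2l => //; exact: ltW.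
have [p_eq1|p_neq1] := eqVneq p 1.
  by move: cut; rewrite p_eq1 hoelder_conjugate1 /= leye_eq.
have p_gt1 : 1 < p by rewrite lt_def p_neq1.
move: cut BE; rewrite hoelder_conjugate_gt1 //= lee_fin => cut BE.
have kap1 : 1 <= kap.
  rewrite kap_exp // -[leLHS]pow1; apply: ge0_ler_powR => //.
  - by rewrite nnegrE.
  - by rewrite nnegrE mulr_ge0 ?powR_ge0.
  - by rewrite mulrC -ler_pdivrMr ?powR_gt0 // div1r.
have nl2 : 1 <= n%:R * l2sq by apply: le_trans kapn; apply: exprn_ege1.
have Bl2 : 1 <= B ^+ 2 * l2sq.
  (* The squared factor 1/2 in [B] cancels the 4 of [l2sq_ge_lp_norm_l1]. *)
  rewrite BE exprMn sqr_sqrtr ?powR_ge0 //.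
  have := @l2sq_ge_lp_norm_l1 p eps _ eps0 epsV V2.
  rewrite p_gt1; case/andP: p12 => _ -> /(_ isT); lra.
split=> //; rewrite -(ler_pXn2r (n := 2)) ?nnegrE ?mulr_ge0 ?sqrtr_ge0 //.
rewrite expr1n !exprMn sqrtn.
have -> : B ^+ 2 * n%:R * l2sq ^+ 2 = (B ^+ 2 * l2sq) * (n%:R * l2sq) by ring.
by apply: mulr_ege1.
Qed.

End LpBounds.

(** * One run of the collision tester *)

(** Here [x] is the sample count, [z] is n^(-1/2), [d] the l_2 distance and [r] the threshold slack.
    Everything is compared with the scale x^2 d^2. *)
Lemma chebyshev_ratio_bound (R : realType) (x z d r : R) :
  45 <= x -> 0 < z <= 1 -> 0 <= d -> 0 <= r -> 45 * z <= x * d ^+ 2 ->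
  45 <= x * d -> r ^+ 2 = 5 * (x * (x - 1) / 2 * z ^+ 2) ->
  0 < x * (x - 1) / 2 * d ^+ 2 - r /\
  x * (x - 1) ^+ 2 * (d ^+ 2 * z ^+ 2 + d ^+ 3)
    + x * (x - 1) / 2 * (z ^+ 2 + d ^+ 2) <=
  4^-1 * (x * (x - 1) / 2 * d ^+ 2 - r) ^+ 2.
Proof.
move=> x45 /andP[z0 z1] d0 r0 zxd xd rE.
have x0 : 0 <= x by lra.
pose Y := x * d ^+ 2.
have Y0 : 0 < Y by rewrite /Y; lra.
have xY0 : 0 < x * Y by rewrite mulr_gt0; lra.
have MX : x * (x - 1) / 2 * d ^+ 2 >= 44 / 90 * (x * Y).
  have : 0 <= (x - 45) * Y by rewrite mulr_ge0; lra.
  by rewrite /Y; nra.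
(* The slack is at most sqrt(5/2) x z, hence at most 1.6 x z, and 45 z is at most [Y]. *)
have r_le : r <= 16 / 450 * (x * Y).
  have xz : 45 * (x * z) <= x * Y by rewrite mulrCA; apply: ler_wpM2l.
  have r_xz : r <= 16 / 10 * (x * z).
    rewrite -(ler_pXn2r (n := 2)) ?nnegrE ?mulr_ge0 ?(ltW z0) //; last by lra.
    rewrite rE; have : 0 <= x * z ^+ 2 by rewrite mulr_ge0 ?sqr_ge0.
    have : 0 <= x ^+ 2 * z ^+ 2 by rewrite mulr_ge0 ?sqr_ge0.
    by rewrite !exprMn; lra.
  by lra.
set t := x * (x - 1) / 2 * d ^+ 2 - r.
(* Indeed 44/90 - 16/450 = 204/450 exceeds 45/100. *)
have t_ge : 45 / 100 * (x * Y) <= t by rewrite /t; lra.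
split; first by apply: lt_le_trans t_ge; rewrite mulr_gt0 //; lra.
have t2 : (45 / 100 * (x * Y)) ^+ 2 <= t ^+ 2.
  by rewrite lerXn2r ?nnegrE //; lra.
set Q := (x * Y) ^+ 2; have QE : Q = x ^+ 4 * d ^+ 4 by rewrite /Q /Y; ring.
have x1 : x * (x - 1) ^+ 2 <= x ^+ 3.
  have -> : x ^+ 3 = x * x ^+ 2 by ring.
  by apply: ler_wpM2l => //; rewrite lerXn2r ?nnegrE //; lra.
have M1 : x * (x - 1) / 2 <= x ^+ 2 / 2 by nra.
have xd2 : 2025 <= (x * d) ^+ 2.
  by rewrite (_ : 2025 = 45 ^+ 2) ?lerXn2r ?nnegrE //; [lra.. | ring].
have B1 : 45 * (x ^+ 3 * d ^+ 3) <= Q.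
  rewrite QE (_ : x ^+ 4 * d ^+ 4 = x * d * (x ^+ 3 * d ^+ 3)); last by ring.
  by apply: ler_wpM2r => //; rewrite mulr_ge0 ?exprn_ge0.
have B2 : 45 * (x ^+ 3 * (d ^+ 2 * z ^+ 2)) <= Q.
  have -> : Q = x ^+ 2 * Y * Y by rewrite /Q; ring.
  have -> : 45 * (x ^+ 3 * (d ^+ 2 * z ^+ 2)) = x ^+ 2 * Y * (45 * z * z).
    by rewrite /Y; ring.
  apply: ler_wpM2l; first by rewrite mulr_ge0 ?sqr_ge0 // ltW.
  by apply: le_trans _ zxd; rewrite ler_piMr //; lra.
have B3 : 2025 * (x ^+ 2 * z ^+ 2) <= Q.
  have -> : 2025 * (x ^+ 2 * z ^+ 2) = (x * (45 * z)) ^+ 2 by ring.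
  rewrite /Q lerXn2r ?nnegrE ?mulr_ge0 ?(ltW z0) ?(ltW Y0) //.
  by apply: ler_wpM2l.
have B4 : 2025 * (x ^+ 2 * d ^+ 2) <= Q.
  rewrite QE (_ : x ^+ 4 * d ^+ 4 = (x * d) ^+ 2 * (x ^+ 2 * d ^+ 2));
    last by ring.
  by apply: ler_wpM2r => //; rewrite mulr_ge0 ?sqr_ge0.
have L1 : x * (x - 1) ^+ 2 * (d ^+ 2 * z ^+ 2 + d ^+ 3) <=
    x ^+ 3 * (d ^+ 2 * z ^+ 2 + d ^+ 3).
  apply: ler_wpM2r => //; apply: addr_ge0; last exact: exprn_ge0.
  by rewrite mulr_ge0 ?sqr_ge0.
have L2 : x * (x - 1) / 2 * (z ^+ 2 + d ^+ 2) <=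
    x ^+ 2 / 2 * (z ^+ 2 + d ^+ 2).
  by rewrite ler_wpM2r // addr_ge0 ?sqr_ge0.
apply: (le_trans (lerD L1 L2)).
have Q0 : 0 <= Q by apply: sqr_ge0.
(* By [B1] to [B4] the variance is at most (2/45 + 1/2025) Q, about 0.045 Q, while a quarter of
   (45/100)^2 Q is about 0.051 Q. *)
move: t2; rewrite exprMn -/Q; lra.
Qed.

Section CollisionTester.
Variables (R : realType) (n m : nat) (A : 'rV[R]_n).
Hypotheses (n_gt0 : (0 < n)%N) (distrA : is_distribution A).

(** The variance is at most the mean [v] and the squared slack is 5 [v], so Chebyshev gives 1/5. *)
Lemma collision_tester_uniform : A = uniform_dist R n ->
  iid_prob A (predC (@collision_tester R (2 / 10) n m)) <= 4^-1.
Proof.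
move=> AU; have nR0 : n%:R != 0 :> R by rewrite pnatr_eq0 -lt0n.
have Ax x : A 0 x = n%:R^-1 by rewrite AU mxE.
have a2 : power_sum A 2 = n%:R^-1.
  rewrite /power_sum; under eq_bigr do rewrite Ax.
  by rewrite sumr_const card_ord -mulr_natl; field.
have a3 : power_sum A 3 = n%:R^-1 ^+ 2.
  rewrite /power_sum; under eq_bigr do rewrite Ax.
  by rewrite sumr_const card_ord -mulr_natl; field.
have := collisions_variance_le distrA m; rewrite a2 a3 subrr mulr0 add0r => var.
have [M0|M_gt0] := posnP 'C(m, 2).
  rewrite iid_probE (eq_iid_mean _ (G := fun=> 0)) ?iid_mean_cst ?invr_ge0 //.
  move=> s /=.
  rewrite /collision_tester /collision_threshold.
  rewrite (le_trans (collisions_le _ s)) //.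
  by rewrite M0 mul0r mulr0 sqrtr0 addr0.
pose v : R := 'C(m, 2)%:R * n%:R^-1.
have v0 : 0 < v by rewrite divr_gt0 ?ltr0n.
have t0 : 0 < (2 / 10)^-1 * v by rewrite mulr_gt0 // invr_gt0; lra.
apply: (le_trans (iid_prob_chebyshev distrA (t := Num.sqrt ((2 / 10)^-1 * v))
  (F := fun s => (collisions s)%:R - v) _ _)).
- by rewrite sqrtr_gt0.
- move=> s /=; rewrite /collision_tester /collision_threshold -/v -ltNge => Ts.
  by apply: le_trans (ler_norm _); rewrite lerBrDl ltW.
rewrite sqr_sqrtr ?(ltW t0) // ler_pdivrMr //; apply: (le_trans var).
by rewrite -/v mulrA; apply: ler_peMl; [exact: ltW | lra].
Qed.

Let V := A - uniform_dist R n.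

Lemma dev_entry x : A 0 x = n%:R^-1 + V 0 x.
Proof. by rewrite !mxE; ring. Qed.

Lemma sum_dev : \sum_x V 0 x = 0.
Proof.
have nR0 : n%:R != 0 :> R by rewrite pnatr_eq0 -lt0n.
have := proj2 distrA; under eq_bigr do rewrite dev_entry.
by rewrite big_split /= sumr_const card_ord -(mulr_natl n%:R^-1) divff //; lra.
Qed.

Lemma sum_norm_dev : \sum_x `|V 0 x| <= 2.
Proof.
have nR0 : n%:R != 0 :> R by rewrite pnatr_eq0 -lt0n.
apply: (@le_trans _ _ (\sum_x (A 0 x + n%:R^-1))).
  apply: ler_sum => x _; rewrite !mxE; apply: (le_trans (ler_normB _ _)).
  by rewrite !ger0_norm ?invr_ge0 //; case: distrA.
by rewrite big_split /= (proj2 distrA) sumr_const card_ord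
  -(mulr_natl n%:R^-1) divff.
Qed.

Lemma power_sum2_dev : power_sum A 2 = n%:R^-1 + \sum_x V 0 x ^+ 2.
Proof.
have nR0 : n%:R != 0 :> R by rewrite pnatr_eq0 -lt0n.
rewrite /power_sum.
rewrite (eq_bigr (fun x => n%:R^-1 * A 0 x + n%:R^-1 * V 0 x + V 0 x ^+ 2)).
  by rewrite !big_split /= -!mulr_sumr (proj2 distrA) sum_dev; ring.
by move=> x _; rewrite dev_entry; ring.
Qed.

Lemma power_sum3_dev : power_sum A 3 =
  n%:R^-1 ^+ 2 + 3 * n%:R^-1 * \sum_x V 0 x ^+ 2 + \sum_x V 0 x ^+ 3.
Proof.
rewrite /power_sum (eq_bigr (fun x => n%:R^-1 ^+ 2 * A 0 x
  + 2 * n%:R^-1 ^+ 2 * V 0 x + 3 * n%:R^-1 * V 0 x ^+ 2 + V 0 x ^+ 3)).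
  by rewrite !big_split /= -!mulr_sumr (proj2 distrA) sum_dev; ring.
by move=> x _; rewrite dev_entry; ring.
Qed.

(** Each entry is at most the l_2 norm, so one factor comes out of the cube. *)
Lemma sum_dev3_le :
  \sum_x V 0 x ^+ 3 <= Num.sqrt (\sum_x V 0 x ^+ 2) ^+ 3.
Proof.
set D := \sum_x V 0 x ^+ 2.
have D0 : 0 <= D by apply: sumr_ge0 => x _; apply: sqr_ge0.
rewrite exprSr sqr_sqrtr // mulr_suml; apply: ler_sum => x _.
rewrite exprSr; apply: ler_wpM2l; first exact: sqr_ge0.
apply: le_trans (ler_norm _) _; rewrite -sqrtr_sqr ler_wsqrtr //.
by rewrite /D (bigD1 x) //= lerDl sumr_ge0 // => y _; apply: sqr_ge0.
Qed.

Lemma power_sum2_le1 : power_sum A 2 <= 1.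
Proof.
case: distrA => A0 A1; rewrite -A1; apply: ler_sum => x _.
have Ax1 : A 0 x <= 1.
  by rewrite -A1 (bigD1 x) //= lerDl sumr_ge0.
by rewrite expr2 -[leRHS]mulr1 ler_wpM2l.
Qed.

(** Acceptance puts the count below its mean by at least 'C(m, 2) D minus the slack. *)
Lemma collision_tester_far :
  45 <= m%:R * Num.sqrt n%:R * \sum_x V 0 x ^+ 2 ->
  45 ^+ 2 <= m%:R ^+ 2 * \sum_x V 0 x ^+ 2 ->
  iid_prob A (@collision_tester R (2 / 10) n m) <= 4^-1.
Proof.
set D := \sum_x V 0 x ^+ 2 => mnD m2D.
have D0 : 0 <= D by apply: sumr_ge0 => x _; apply: sqr_ge0.
have y1 : 1 <= Num.sqrt n%:R :> R by rewrite -[leLHS]sqrtr1 ler_wsqrtr // ler1n.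
have y0 : 0 < Num.sqrt n%:R :> R by apply: lt_le_trans y1.
have y2 : Num.sqrt n%:R ^+ 2 = n%:R :> R by rewrite sqr_sqrtr.
pose z : R := (Num.sqrt n%:R)^-1; pose d := Num.sqrt D.
have z2 : z ^+ 2 = n%:R^-1 by rewrite exprVn y2.
have d2 : d ^+ 2 = D by rewrite sqr_sqrtr.
have d0 : 0 <= d by apply: sqrtr_ge0.
have D1 : D <= 1.
  have := power_sum2_le1; rewrite power_sum2_dev -/D.
  have : 0 <= n%:R^-1 :> R by rewrite invr_ge0.
  lra.
have md : 45 <= m%:R * d.
  by rewrite -(ler_pXn2r (n := 2)) ?nnegrE ?mulr_ge0 // exprMn d2.
have m45 : 45 <= m%:R :> R.
  have d1 : d <= 1 by rewrite -sqrtr1 ler_wsqrtr.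
  by apply: le_trans md _; rewrite ler_piMr.
have m1 : m.-1%:R = m%:R - 1 :> R.
  case: (m) m45 => [m45|m' _]; first by lra.
  by rewrite -natr1; ring.
pose r := Num.sqrt ((2 / 10)^-1 * ('C(m, 2)%:R * n%:R^-1) : R).
have r2 : r ^+ 2 = 5 * (m%:R * (m%:R - 1) / 2 * z ^+ 2).
  rewrite sqr_sqrtr ?mulr_ge0 ?invr_ge0 //; last by lra.
  by rewrite binR2 m1 z2; field; rewrite pnatr_eq0 -lt0n.
have z01 : 0 < z <= 1 by rewrite invr_gt0 y0 invf_le1.
have zmd : 45 * z <= m%:R * d ^+ 2.
  by rewrite ler_pdivrMr // d2 mulrAC.
have [t0 var_le] := chebyshev_ratio_bound m45 z01 d0 (sqrtr_ge0 _) zmd md r2.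
apply: (le_trans (iid_prob_chebyshev distrA t0
  (F := fun s => (collisions s)%:R - 'C(m, 2)%:R * power_sum A 2) _)).
  move=> s; rewrite /collision_tester /collision_threshold -/r => sT.
  rewrite ler_normr; apply/orP; right.
  rewrite power_sum2_dev -/D d2 -m1 -binR2; lra.
rewrite ler_pdivrMr ?exprn_gt0 //; apply: le_trans var_le.
apply: (le_trans (collisions_variance_le distrA m)).
rewrite binR2 m1 power_sum2_dev power_sum3_dev -/D d2 z2; apply: lerD => //.
have -> : 2 * (m%:R * (m%:R - 1) / 2) * (m%:R - 1) =
  m%:R * (m%:R - 1) ^+ 2 :> R by field.
apply: ler_wpM2l; first by rewrite mulr_ge0 ?sqr_ge0.
(* The linear variance factor is D/n plus the sum of cubes minus D^2; the last term is dropped. *)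
have := sum_dev3_le; rewrite -/D -/d; have := sqr_ge0 D; lra.
Qed.

End CollisionTester.

(** * Rounding and assembly *)

Lemma nat_ceilP (R : realType) (x : R) : 0 <= x ->
  x <= (nat_ceil x)%:R < x + 1.
Proof.
move=> x0; have c0 : 0 <= Num.ceil x by rewrite ceil_ge0; lra.
rewrite /nat_ceil natr_absz ger0_norm // ceil_ge /=.
by have := ceilB1_lt x; rewrite intrB /=; lra.
Qed.

Theorem theorem2 (R : realType) (p : R) (n : nat) (eps delta B : R)
    (tie : bool) :
  1 <= p <= 2 -> (2 <= n)%N -> 0 < eps < 1 -> 0 < delta < 2^-1 ->
  sample_factor p n eps B ->
  let runs : R := 160 / 9 * ln (delta^-1) in
  let samples_per_run : R := 45 * B in
  let m : R := 800 * ln (delta^-1) * B in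
  let k := nat_ceil runs in
  let m' := nat_ceil samples_per_run in
  [/\ runs * samples_per_run = m,
      m <= #|{: 'I_k * 'I_m'}|%:R < (runs + 1) * (samples_per_run + 1) &
      solves_uniformity_testing p eps delta
        (@majority_collision_tester R tie (2 / 10) n k m')].
Proof.
move=> p12 n2 eps01 delta01 Bdef runs samples m k m'.
have n0 : (0 < n)%N by apply: ltn_trans n2.
have B0 : 0 <= B by apply: sample_factor_ge0 Bdef; case/andP: eps01 => /ltW.
have runs0 : 0 <= runs.
  rewrite mulr_ge0 //; first by lra.
  case/andP: delta01 => d0 d1; rewrite ln_ge0 // invf_ge1 //; lra.
have samples0 : 0 <= samples by rewrite mulr_ge0.
have mE : runs * samples = m by rewrite /runs /samples /m; field.
have /andP[k_ge k_lt] := nat_ceilP runs0.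
have /andP[m_ge m_lt] := nat_ceilP samples0.
split=> //.
  rewrite card_prod !card_ord natrM -mE ler_pM //=.
  by rewrite ltr_pM.
have delta_k := expn78_le delta01 k_ge.
move=> A distrA; split => [AU|epsA].
  apply: le_trans (majority_collision_tester_accepts distrA tie k _).
    by rewrite lerD2l lerN2.
  exact: collision_tester_uniform.
apply: le_trans (majority_collision_tester_rejects distrA tie k _).
  by rewrite lerD2l lerN2.
have [sep1 sep2] := sample_factor_separates p12 n0 eps01 Bdef epsA
  (sum_norm_dev n0 distrA).
have D0 : 0 <= \sum_x (A - uniform_dist R n) 0 x ^+ 2.
  by apply: sumr_ge0 => x _; apply: sqr_ge0.
(* Rounding up keeps m' at least 45 B, which restores the constants 45 and 45^2. *)
apply: collision_tester_far => //.
  apply: (@le_trans _ _ (45 * (B * Num.sqrt n%:R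
    * \sum_x (A - uniform_dist R n) 0 x ^+ 2))); first by lra.
  by rewrite !mulrA ler_wpM2r // ler_wpM2r ?sqrtr_ge0.
apply: (@le_trans _ _ (45 ^+ 2 * (B ^+ 2
    * \sum_x (A - uniform_dist R n) 0 x ^+ 2))); first by lra.
by rewrite mulrA -exprMn ler_wpM2r // lerXn2r // nnegrE.
Qed.
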